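(* There exists a set $\mathcal{A}$ of positive integers which is a Sidon set and is an asymptotic basis of order $4$.
   Context: A set $\mathcal{A}$ of positive integers is a Sidon set if all sums $a+b$ with $a,b\in\mathcal{A}$, $a\le b$, are distinct. For an integer $h\ge 2$, $\mathcal{A}$ is an asymptotic basis of order $h$ if there is $n_0$ such that every integer $n>n_0$ can be written as $n=a_1+\dots+a_h$ with $a_1,\dots,a_h\in\mathcal{A}$ (repetitions allowed). *)

(* Defs.v *)
From mathcomp Require Import all_boot.
From mathcomp Require Import classical_sets.

Set Implicit Arguments.
Unset Strict Implicit.
Unset Printing Implicit Defensive.

Local Open Scope classical_set_scope.

Definition positive_set (A : set nat) : Prop := A `<=` [set a | 0 < a].

Definition sidon (A : set nat) : Prop :=
  forall a b c d : nat, A a -> A b -> A c -> A d ->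
    a <= b -> c <= d -> a + b = c + d -> a = c /\ b = d.

(* The summands form a family indexed by 'I_h, so repetitions are allowed. *)
Definition asymptotic_basis (h : nat) (A : set nat) : Prop :=
  exists n0 : nat, forall n : nat, n0 < n ->
    exists a : 'I_h -> nat, (forall i, A (a i)) /\ n = \sum_(i < h) a i.

(* Main.v *)
(* The set is the union of an increasing chain of finite Sidon sets; the stage
   with L = 256 m^4 and m = 2^e adds O(e m) elements and makes every n in
   ]L/16, L] a sum of four elements. The total size O(e 2^e) of the set A built
   so far stays far below L^(1/3), so A can first be extended greedily until 2A
   contains m^2 distinct small sums s. Then 2m elements X_i, Y_j of [1, L] are
   drawn at random, and those taking part in a nontrivial x + y = z + w with the
   others or with A are deleted, so that A stays Sidon. For a still uncovered n,
   the expected number of solutions of n = X_i + Y_j + s is of order m^4 / L, a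
   constant; the expected number spoilt by a deletion is O(m^4 |A|^3 / L^2),
   which is negligible, and pairs of solutions are rare, so n gets covered with
   probability bounded below. Some choice covers a fixed proportion of the
   uncovered n, and O(e) rounds cover all of them. *)

Require Import Defs.
From mathcomp Require Import all_boot.
From mathcomp Require Import zify.

Set Implicit Arguments.
Unset Strict Implicit.
Unset Printing Implicit Defensive.

(** * Counting functions through two of their coordinates *)

Section TwoCoordinates.

Variables (I : finType) (L : nat) (u v : I).
Hypothesis uv : u != v.
Implicit Types f g : {ffun I -> 'I_L}.

Definition upd2 f (p : 'I_L * 'I_L) : {ffun I -> 'I_L} :=
  [ffun w => if w == u then p.1 else if w == v then p.2 else f w].

Lemma upd2_eq f g p q :
  upd2 f p = upd2 g q ->
  p = q /\ forall w, w != u -> w != v -> f w = g w.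
Proof.
move=> /ffunP E; split.
  move: (E u) (E v); rewrite !ffunE eqxx eq_sym (negPf uv) eqxx.
  by case: p q {E} => [a b] [c d] /= -> ->.
by move=> w /negPf wu /negPf wv; move: (E w); rewrite !ffunE wu wv.
Qed.

(** Overwriting the coordinates [u] and [v] by all [L ^ 2] pairs is injective on [E]. Read as
    probability: two equations that determine [f u] and [f v] from the rest hold with probability at
    most 1/L^2. *)
Lemma card_determined (E : {set {ffun I -> 'I_L}}) :
  (forall f g, f \in E -> g \in E ->
     (forall w, w != u -> w != v -> f w = g w) -> f = g) ->
  #|E| * L ^ 2 <= #|{ffun I -> 'I_L}|.
Proof.
move=> EP.
pose D := setX E [set: 'I_L * 'I_L].
have <- : #|D| = #|E| * L ^ 2 by rewrite cardsX cardsT card_prod card_ord.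
rewrite -(card_in_imset (f := fun x => upd2 x.1 x.2)) ?max_card //.
move=> [f p] [g q]; rewrite !inE /= !andbT => fE gE /upd2_eq[-> fg].
by rewrite (EP _ _ fE gE fg).
Qed.

(** Swapping [p] with [(f u, f v)] is injective; this is one half of the uniformity of that pair
    under a random [f]. *)
Lemma card_pair_rel (R : rel 'I_L) :
  #|{ffun I -> 'I_L}| * #|[set p | R p.1 p.2]| <=
    #|[set f : {ffun I -> 'I_L} | R (f u) (f v)]| * L ^ 2.
Proof.
pose D := setX [set: {ffun I -> 'I_L}] [set p | R p.1 p.2].
pose E := setX [set f : {ffun I -> 'I_L} | R (f u) (f v)] [set: 'I_L * 'I_L].
have <- : #|D| = #|{ffun I -> 'I_L}| * #|[set p | R p.1 p.2]|.
  by rewrite cardsX cardsT.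
rewrite (_ : _ * _ = #|E|); last by rewrite cardsX cardsT card_prod card_ord.
pose h (x : {ffun I -> 'I_L} * ('I_L * 'I_L)) := (upd2 x.1 x.2, (x.1 u, x.1 v)).
rewrite -(card_in_imset (f := h) (D := D)).
  apply/subset_leq_card/subsetP => _ /imsetP[[f p] + ->].
  by rewrite !inE /= !ffunE !eqxx eq_sym (negPf uv) andbT.
move=> [f p] [g q] _ _ [] /upd2_eq[-> fg] fgu fgv; congr pair.
apply/ffunP => w; have [->//|wu] := eqVneq w u; have [->//|wv] := eqVneq w v.
exact: fg.
Qed.

End TwoCoordinates.

(** * Sidon sequences, sumsets and a Bonferroni inequality *)

Definition sidon_seq (A : seq nat) : Prop :=
  forall a b c d, a \in A -> b \in A -> c \in A -> d \in A ->
    a + b = c + d -> a = c \/ a = d.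

Definition sums2 (A : seq nat) := [seq a + b | a <- A, b <- A].
Definition sums4 (A : seq nat) := [seq s + t | s <- sums2 A, t <- sums2 A].

Lemma sums2P A n :
  reflect (exists a b, [/\ a \in A, b \in A & n = a + b]) (n \in sums2 A).
Proof.
apply: (iffP allpairsP) => [[[a b] /= []]|[a [b []]]]; first by exists a, b.
by exists (a, b).
Qed.

Lemma sums4P A n :
  reflect (exists s t, [/\ s \in sums2 A, t \in sums2 A & n = s + t])
    (n \in sums4 A).
Proof.
apply: (iffP allpairsP) => [[[a b] /= []]|[a [b []]]]; first by exists a, b.
by exists (a, b).
Qed.

Lemma sums2_sub A B : {subset A <= B} -> {subset sums2 A <= sums2 B}.
Proof.
move=> AB n /sums2P[a [b [/AB aB /AB bB ->]]]; apply/sums2P.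
by exists a, b.
Qed.

Lemma sums4_sub A B : {subset A <= B} -> {subset sums4 A <= sums4 B}.
Proof.
move=> /sums2_sub AB n /sums4P[a [b [/AB aB /AB bB ->]]]; apply/sums4P.
by exists a, b.
Qed.

(* Each hit is either bad, or unique, or part of a pair of distinct hits. *)
Lemma bonferroni (Q : finType) (hit bad : pred Q) :
  #|[set p | hit p]| <=
    [exists p, hit p && ~~ bad p] + #|[set p | hit p && bad p]| +
    #|[set x : Q * Q | [&& x.1 != x.2, hit x.1 & hit x.2]]|.
Proof.
case: (boolP [exists p, _]) => [/existsP[p0 /andP[h0 _]]|/existsPn nobad].
  rewrite (cardsD1 p0) inE h0 addnAC -addnA leq_add2l.
  rewrite -(card_imset _ (f := fun p => (p0, p))); last by move=> ? ? [].
  apply: (leq_trans _ (leq_addr _ _)).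
  apply/subset_leq_card/subsetP => _ /imsetP[p + ->].
  by rewrite !inE /= h0 eq_sym => /andP[-> ->].
rewrite add0n; apply: (leq_trans _ (leq_addr _ _)).
apply/subset_leq_card/subsetP => p; rewrite !inE => hp.
by move: (nobad p); rewrite hp /= negbK.
Qed.

(** * Random elements and the deletion of bad ones *)

Section Block.

Variables (L : nat) (I : finType) (A : seq nat).
Implicit Types (f g : {ffun I -> 'I_L}) (u v w : I).

(* A name denotes an element of the extended set independently of the choice
   of the random elements [f]: either the k-th element of [A] or a variable. *)
Definition name : finType := ('I_(size A) + I)%type.
Implicit Types x y z : name.

Definition value f x : nat :=
  match x with inl k => nth 0 A k | inr v => (f v).+1 end.

(** Triviality is judged by values, not by names: a random element that repeats another one is
    harmless. *)
Definition clash f v x y z :=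
  [&& (f v).+1 + value f x == value f y + value f z,
      (f v).+1 != value f y & (f v).+1 != value f z].

Definition bad f v :=
  [exists t : name * name * name, clash f v t.1.1 t.1.2 t.2].

(* The two equations are independent: the only clash proportional to the first
   one is [f u + f v = a + a'] with [a, a' \in A], and then [n] is in [4A]. *)
Lemma card_clash n c u v x y z :
  u != v -> c \in sums2 A -> n \notin sums4 A ->
  #|[set f : {ffun I -> 'I_L} |
      ((f u).+1 + (f v).+1 + c == n) && clash f u x y z]| * L ^ 2 <=
    #|{ffun I -> 'I_L}|.
Proof.
move=> uv cA nA.
have nE k k' : n <> nth 0 A k + nth 0 A k' + c \/ size A <= k \/ size A <= k'.
  case: (leqP (size A) k) => [|kA]; first by right; left.
  case: (leqP (size A) k') => [|k'A]; first by right; right.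
  left=> nE; case/negP: nA; rewrite nE; apply/sums4P.
  exists (nth 0 A k + nth 0 A k'), c; split=> //; apply/sums2P.
  by exists (nth 0 A k), (nth 0 A k'); rewrite !mem_nth.
pose free w := [&& w != u, w != v & (inr w : name) \in [:: x; y; z]].
(* If a third variable [w] occurs in the clash, the first equation gives [f u] and the clash then
   gives [f w], which cancels only in a trivial clash. *)
case: (pickP free) => [w /and3P[wu wv]|noW].
{ rewrite !inE => wxyz; apply: (card_determined (u := u) (v := w)).
    by rewrite eq_sym.
  move=> f g; rewrite !inE => /andP[/eqP f1 f2] /andP[/eqP g1 g2] fg.
  have fgv : f v = g v by apply: fg; rewrite // eq_sym.
  have fgu : f u = g u by apply/val_inj => /=; move: f1 g1; rewrite fgv; lia.
  have E t : t != inr w -> value f t = value g t.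
    case: t => [//|w' /=]; have [->//|w'u ne] := eqVneq w' u.
      by rewrite fgu.
    by rewrite fg //; apply: contraNneq ne => ->.
  suff fgw : (f w).+1 = (g w).+1.
    apply/ffunP => w'; have [->//|w'u] := eqVneq w' u.
    have [->|w'w] := eqVneq w' w; last exact: fg.
    by apply/val_inj; case: fgw.
  move: f2 g2 wxyz; rewrite /clash fgu => /and3P[/eqP f2 /eqP f3 /eqP f4].
  move=> /and3P[/eqP g2 /eqP g3 /eqP g4]; move: f2 f3 f4 g2 g3 g4.
  have [<-|/eqP xw] := eqVneq (inr w) x; have [<-|/eqP yw] := eqVneq (inr w) y;
    have [<-|/eqP zw] := eqVneq (inr w) z => //=.
  all: rewrite ?(E x) ?(E y) ?(E z); try by apply/eqP => ?; subst.
  all: lia.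
}
(* Otherwise both equations involve only [f u] and [f v]; the first fixes their sum, so [f u]
   suffices. *)
apply: (card_determined uv) => f g.
rewrite !inE => /andP[/eqP f1 f2] /andP[/eqP g1 g2] fg.
suff fgu : f u = g u :> nat.
  have fgv : f v = g v :> nat by lia.
  apply/ffunP => w; have [->|wu] := eqVneq w u; first exact/val_inj.
  have [->|wv] := eqVneq w v; first exact/val_inj.
  exact: fg.
have cases t : t \in [:: x; y; z] ->
    (exists2 k, k < size A & forall h, value h t = nth 0 A k) \/
    (forall h, value h t = (h u).+1) \/ (forall h, value h t = (h v).+1).
  case: t => [k _|w tin]; first by left; exists k.
  right; have [->|wu] := eqVneq w u; first by left.
  have [->|wv] := eqVneq w v; first by right.
  by move: (noW w); rewrite /free wu wv tin.
move: f2 g2; rewrite /clash.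
have [|[k1 k1A Ex]|[Ex|Ex]] := cases x; first by rewrite !inE eqxx.
all: have [|[k2 k2A Ey]|[Ey|Ey]] := cases y; first by rewrite !inE eqxx orbT.
all: have [|[k3 k3A Ez]|[Ez|Ez]] := cases z; first by rewrite !inE eqxx !orbT.
all: rewrite !Ex !Ey !Ez; try by have := nE k2 k3; lia.
all: lia.
Qed.


Definition extend f : seq nat :=
  A ++ [seq (f v).+1 | v <- enum I & ~~ bad f v].

Lemma mem_extend f a : a \in extend f ->
  a \in A \/ exists2 v, ~~ bad f v & a = (f v).+1.
Proof.
rewrite mem_cat => /orP[]; first by left.
by case/mapP => v; rewrite mem_filter => /andP[nbv _] ->; right; exists v.
Qed.

Lemma extend_var f v : ~~ bad f v -> (f v).+1 \in extend f.
Proof.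
by move=> nbv; rewrite mem_cat map_f ?orbT // mem_filter nbv mem_enum.
Qed.

Lemma sub_extend f : {subset A <= extend f}.
Proof. by move=> a aA; rewrite mem_cat aA. Qed.

Lemma size_extend f : size (extend f) <= size A + #|I|.
Proof.
rewrite size_cat size_map leq_add2l cardE size_filter.
exact: count_size.
Qed.

(** An equation containing a surviving variable is trivial because that variable is not bad; the
    equation is turned so that this variable comes first. Otherwise all four terms lie in [A]. *)
Lemma sidon_extend f : sidon_seq A -> sidon_seq (extend f).
Proof.
move=> sA.
have named a : a \in extend f -> exists x, value f x = a.
  case/mem_extend => [aA|[v _ ->]]; last by exists (inr v).
  have kA : index a A < size A by rewrite index_mem.
  by exists (inl (Ordinal kA)); rewrite /= nth_index.
have nonbad v b c d : ~~ bad f v ->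
    b \in extend f -> c \in extend f -> d \in extend f ->
    (f v).+1 + b = c + d -> (f v).+1 = c \/ (f v).+1 = d.
  move=> /existsPn nb /named[x <-] /named[y <-] /named[z <-] e.
  move: (nb (x, y, z)); rewrite /clash /= e eqxx /= negb_and !negbK.
  by case/orP => /eqP ->; [left | right].
move=> a b c d aX bX cX dX e.
case: (mem_extend aX) => [aA|[v nb av]]; last first.
  by rewrite av; apply: (nonbad v b); rewrite -?av.
case: (mem_extend bX) => [bA|[v nb av]]; last first.
  case: (nonbad v a c d nb); rewrite -?av //; lia.
case: (mem_extend cX) => [cA|[v nb av]]; last first.
  case: (nonbad v d a b nb); rewrite -?av //; lia.
case: (mem_extend dX) => [dA|[v nb av]]; last first.
  case: (nonbad v c a b nb); rewrite -?av //; lia.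
exact: (sA a b c d).
Qed.

End Block.

(** * Double counting, averaging and pairs with a given sum *)

(** The equations determine [f u] and [f u'] from the rest. The case [v = v'] is allowed, so hits
    sharing one variable are covered. *)
Lemma card_two_sums L (I : finType) (u v u' v' : I) c c' n :
  u != v -> u != u' -> u != v' -> u' != v -> u' != v' ->
  #|[set f : {ffun I -> 'I_L} | ((f u).+1 + (f v).+1 + c == n) &&
      ((f u').+1 + (f v').+1 + c' == n)]| * L ^ 2 <= #|{ffun I -> 'I_L}|.
Proof.
move=> uv uu' uv' u'v u'v'; apply: (card_determined uu') => f g.
rewrite !inE => /andP[/eqP f1 /eqP f2] /andP[/eqP g1 /eqP g2] fg.
have ev : f v = g v by rewrite fg // eq_sym.
have ev' : f v' = g v' by rewrite fg // eq_sym.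
apply/ffunP => w; have [->|wu] := eqVneq w u.
  by apply/val_inj => /=; move: f1 g1; rewrite ev; lia.
have [->|wu'] := eqVneq w u'; last exact: fg.
by apply/val_inj => /=; move: f2 g2; rewrite ev'; lia.
Qed.

Lemma card_set_sum (X : finType) (P : pred X) : #|[set x | P x]| = \sum_x P x.
Proof. by rewrite -sum1dep_card big_mkcond; apply: eq_bigr => x _; case: P. Qed.

Lemma double_counting (X Y : finType) (P : X -> pred Y) :
  \sum_x #|[set y | P x y]| = \sum_y #|[set x | P x y]|.
Proof.
under eq_bigr do rewrite card_set_sum.
by rewrite exchange_big; apply: eq_bigr => y _; rewrite card_set_sum.
Qed.

Lemma ex_average (X : finType) (c : X -> nat) :
  0 < #|X| -> exists x, \sum_x c x <= #|X| * c x.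
Proof.
case/card_gt0P => x0 _; exists [arg max_(x > x0) c x].
case: arg_maxnP => // x _ xmax; rewrite -sum_nat_const; apply: leq_sum => y _.
exact: xmax.
Qed.

Lemma card_sum_pairs L K c n : c + K < n <= L ->
  K <= #|[set p : 'I_L * 'I_L | p.1.+1 + p.2.+1 + c == n]|.
Proof.
move=> /andP[cKn nL].
have k1 (k : 'I_K) : k < L by have := ltn_ord k; lia.
(* [k.+2] makes up for the two successors in the sum. *)
have k2 (k : 'I_K) : n - c - k.+2 < L by have := ltn_ord k; lia.
pose h k := (Ordinal (k1 k), Ordinal (k2 k)).
rewrite -[leqLHS]card_ord -(card_imset (f := h)); last first.
  by move=> k k' [kk' _]; apply: val_inj.
apply/subset_leq_card/subsetP => _ /imsetP[k _ ->].
by rewrite inE /=; have := ltn_ord k; lia.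
Qed.

(** * Expectations for one random block *)

Section RandomBlock.

Variables (L m K : nat) (A : seq nat) (T : finType) (s : T -> nat).
Hypothesis s_inj : injective s.
Hypothesis sA : forall e, s e \in sums2 A.

Notation I := ('I_m + 'I_m)%type.
Notation F := {ffun I -> 'I_L}.
Notation Q := ('I_m * 'I_m * T)%type.
Notation names := (size A + #|{: I}|).
Implicit Type q : Q.

Definition hit n (f : F) q :=
  (f (inl q.1.1)).+1 + (f (inr q.1.2)).+1 + s q.2 == n.

Definition spoilt (f : F) q := bad A f (inl q.1.1) || bad A f (inr q.1.2).

(** Expectations are written as sums over all [f], with denominators cleared. Each triple is a hit
    with probability at least K/L^2, by the [K] ways to split [n - s e]. *)
Lemma hits_lb n : (forall e, s e + K < n <= L) ->
  #|{: Q}| * K * #|{: F}| <= (\sum_(f : F) #|[set q | hit n f q]|) * L ^ 2.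
Proof.
move=> sn; rewrite double_counting big_distrl /= -mulnA -sum_nat_const.
apply: leq_sum => -[[i j] e] _ /=.
apply: (leq_trans _ (card_pair_rel (u := inl i) (v := inr j) _
  (fun a b => a.+1 + b.+1 + s e == n))) => //.
by rewrite mulnC leq_mul2l card_sum_pairs ?orbT.
Qed.

Lemma card_name : #|{: name I A}| = names.
Proof. by rewrite card_sum card_ord. Qed.

(** Union bound over the triples of names that can witness badness. *)
Lemma card_hit_bad n c (u v : I) :
  u != v -> c \in sums2 A -> n \notin sums4 A ->
  #|[set f : F | ((f u).+1 + (f v).+1 + c == n) && bad A f u]| * L ^ 2 <=
    names ^ 3 * #|{: F}|.
Proof.
move=> uv cA nA.
pose P (t : name I A * name I A * name I A) (f : F) :=
  ((f u).+1 + (f v).+1 + c == n) && clash f u t.1.1 t.1.2 t.2.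
have le1 : #|[set f : F | ((f u).+1 + (f v).+1 + c == n) && bad A f u]| <=
    \sum_t #|[set f | P t f]|.
  rewrite -double_counting card_set_sum; apply: leq_sum => f _.
  case: andP => // -[h /existsP[t ct]]; rewrite lt0n cards_eq0.
  by apply/set0Pn; exists t; rewrite inE /P h.
apply: (leq_trans (leq_mul le1 (leqnn _))); rewrite big_distrl /=.
rewrite -card_name (_ : _ ^ 3 = #|{: name I A * name I A * name I A}|).
  by rewrite -sum_nat_const; apply: leq_sum => t _; apply: card_clash.
by rewrite !card_prod !expnS expn0 muln1 mulnA.
Qed.

Lemma spoilt_ub n : n \notin sums4 A ->
  (\sum_(f : F) #|[set q | hit n f q && spoilt f q]|) * L ^ 2 <=
    #|{: Q}| * (2 * names ^ 3) * #|{: F}|.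
Proof.
move=> nA; rewrite double_counting big_distrl /= -mulnA -sum_nat_const.
apply: leq_sum => -[[i j] e] _ /=.
set E := [set f | _].
pose E1 := [set f : F | ((f (inl i)).+1 + (f (inr j)).+1 + s e == n)
  && bad A f (inl i)].
pose E2 := [set f : F | ((f (inr j)).+1 + (f (inl i)).+1 + s e == n)
  && bad A f (inr j)].
have EE : #|E| <= #|E1| + #|E2|.
  apply: leq_trans (leq_card_setU _ _); apply/subset_leq_card/subsetP => f.
  rewrite !inE /hit /spoilt /= => /andP[/eqP h b]; rewrite h eqxx /=.
  by rewrite [(f (inr j)).+1 + _]addnC h eqxx.
apply: (leq_trans (leq_mul EE (leqnn _))).
by rewrite mulnDl mul2n -addnn mulnDl leq_add // card_hit_bad.
Qed.

(** If [i] or [j] differs, the two equations are independent; if both agree, the sums [s e] and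
    [s e'] differ and the hits exclude each other. *)
Lemma coincidences_ub n :
  (\sum_(f : F) #|[set x : Q * Q | [&& x.1 != x.2, hit n f x.1 & hit n f x.2]]|)
    * L ^ 2 <= #|{: Q}| ^ 2 * #|{: F}|.
Proof.
rewrite double_counting big_distrl /= -[#|{: Q}| ^ 2]mulnn -card_prod.
rewrite -sum_nat_const; apply: leq_sum => -[[[i j] e] [[i' j'] e']] _ /=.
have [<-|ne] := eqVneq (i, j, e) (i', j', e').
  by rewrite (_ : [set _ | _] = set0) ?cards0 //; apply/setP => f; rewrite !inE.
rewrite /hit /=; have [ii'|ii'] := eqVneq i i'; last exact: card_two_sums.
have [jj'|jj'] := eqVneq j j'.
  rewrite (_ : [set _ | _] = set0) ?cards0 //; apply/setP => f; rewrite !inE.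
  apply/negP => /andP[/eqP f1 /eqP f2]; case/eqP: ne.
  by congr (_, _, _) => //; apply: s_inj; move: f1 f2; rewrite ii' jj'; lia.
have := card_two_sums L (u := inr j) (v := inl i) (u' := inr j') (v' := inl i')
  (s e) (s e') n isT jj' isT isT isT.
congr (_ * _ <= _); apply: eq_card => f.
by rewrite !inE [_.+1 + (f (inl i)).+1]addnC [_.+1 + (f (inl i')).+1]addnC.
Qed.

Lemma sums4_extend n (f : F) q :
  hit n f q -> ~~ spoilt f q -> n \in sums4 (extend A f).
Proof.
move=> /eqP <-; rewrite negb_or => /andP[nb1 nb2]; apply/sums4P.
eexists _, _; split; last reflexivity.
  by apply/sums2P; eexists _, _; split; last reflexivity; apply: extend_var.
exact: sums2_sub (@sub_extend _ _ _ f) _ (sA _).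
Qed.

Lemma covering_lb n :
  n \notin sums4 A -> (forall e, s e + K < n <= L) ->
  #|{: Q}| * K * #|{: F}| <=
    (\sum_(f : F) (n \in sums4 (extend A f))) * L ^ 2 +
    (#|{: Q}| * (2 * names ^ 3) + #|{: Q}| ^ 2) * #|{: F}|.
Proof.
move=> nA sn; apply: (leq_trans (hits_lb sn)).
rewrite mulnDl; apply: leq_trans (leq_add (leqnn _)
  (leq_add (spoilt_ub nA) (coincidences_ub n))).
rewrite -!mulnDl leq_mul2r; apply/orP; right; rewrite -!big_split /=.
apply: leq_sum => f _; rewrite addnA.
apply: (leq_trans (bonferroni _ (spoilt f))); rewrite !leq_add2r.
case: existsP => // -[q /andP[hq nq]].
by rewrite (sums4_extend hq nq).
Qed.

(** Summing [covering_lb] over [U], some [f] does at least as well as the mean. *)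
Lemma random_block (U : seq nat) :
  0 < L -> (forall n, n \in U -> n \notin sums4 A) ->
  (forall n e, n \in U -> s e + K < n <= L) ->
  exists f : F,
    size U * (#|{: Q}| * K) <= count (mem (sums4 (extend A f))) U * L ^ 2 +
      size U * (#|{: Q}| * (2 * names ^ 3) + #|{: Q}| ^ 2).
Proof.
move=> L0 UA Us.
have F0 : 0 < #|{: F}| by rewrite card_ffun card_ord expn_gt0 L0.
have [f fmax] :=
  ex_average (fun f : F => count (mem (sums4 (extend A f))) U) F0.
exists f; rewrite -(leq_pmul2r F0) [leqRHS]mulnDl.
set R := _ + #|{: Q}| ^ 2.
have : size U * (#|{: Q}| * K) * #|{: F}| <=
  (\sum_(f : F) count (mem (sums4 (extend A f))) U) * L ^ 2 +
  size U * R * #|{: F}|.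
  under eq_bigr do rewrite -sum1_count big_mkcond /=.
  rewrite exchange_big /= -sum1_size !big_distrl /= -big_split /=.
  rewrite big_seq [leqRHS]big_seq; apply: leq_sum => n nU; rewrite !mul1n.
  exact: covering_lb (UA _ nU) (fun e => Us n e nU).
move=> /leq_trans; apply; rewrite leq_add2r.
by rewrite mulnAC leq_mul2r mulnC fmax orbT.
Qed.

End RandomBlock.

(** * Greedy extension with many distinct small sums *)

(** A new element only has to avoid the values b + c - d and (b + c)/2, with b, c, d in [A]. *)
Lemma greedy_step A X : sidon_seq A -> 3 * size A ^ 3 < X ->
  exists x, [/\ 0 < x <= X, x \notin A & sidon_seq (x :: A)].
Proof.
move=> sA AX.
pose forb1 := [seq t - d | t <- sums2 A, d <- A].
pose forb2 := [seq t./2 | t <- sums2 A].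
have [/allP sub|/allPn[x xX xF]] :=
  boolP (all (mem (forb1 ++ forb2)) (iota 1 X)).
  have := uniq_leq_size (iota_uniq 1 X) sub.
  rewrite size_iota size_cat size_map !size_allpairs; nia.
move: xX xF; rewrite mem_iota inE mem_cat negb_or => xX /andP[x1 x2].
have F1 b c d : b \in A -> c \in A -> d \in A -> x + d <> b + c.
  move=> bA cA dA e; case/negP: x1; apply/allpairsP; exists (b + c, d).
  by split=> //=; [apply/sums2P; exists b, c | lia].
have F2 b c : b \in A -> c \in A -> x + x <> b + c.
  move=> bA cA e; case/negP: x2; apply/mapP; exists (b + c); last by lia.
  by apply/sums2P; exists b, c.
exists x; split; first lia.
  by apply/negP => xA; apply: (F1 x x x).
move=> a b c d; rewrite !inE.
case/predU1P=> [->|aA]; case/predU1P=> [->|bA]; case/predU1P=> [->|cA];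
  case/predU1P=> [->|dA] e; try (by left); try (by right); try lia.
- by case: (F2 c d).
- by case: (F1 c d b).
- by case: (F1 c d a) => //; lia.
- by case: (F2 a b).
- by case: (F1 a b d).
- by case: (F1 a b c) => //; lia.
- exact: (sA a b c d).
Qed.

Lemma greedy A X k : sidon_seq A -> 3 * (size A + k) ^ 3 < X ->
  exists G : seq nat, [/\ size G = k, uniq G, forall x, x \in G -> 0 < x <= X
    & sidon_seq (G ++ A)].
Proof.
move=> sA; elim: k => [|k IH] kX.
  by exists [::]; split.
have [|G [sG uG GX sGA]] := IH; first by apply: leq_ltn_trans kX; nia.
have [|x [xX xG sx]] := greedy_step (X := X) sGA.
  by apply: leq_ltn_trans kX; rewrite size_cat sG addnC; nia.
move: xG; rewrite mem_cat negb_or => /andP[xG _].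
exists (x :: G); split=> //=; rewrite ?sG ?xG // => y.
by rewrite inE => /predU1P[->//|/GX].
Qed.

(** The first half of the [2 * q] new elements is added to the second half; by the Sidon property
    two equal sums could only differ by a swap, which would identify elements of different
    halves. *)
Lemma greedy_sums A X q : sidon_seq A -> 0 \notin A ->
  3 * (size A + 2 * q) ^ 3 < X ->
  exists (A' : seq nat) (s : 'I_q * 'I_q -> nat),
    [/\ {subset A <= A'}, sidon_seq A', 0 \notin A' & size A' = size A + 2 * q]
    /\ [/\ injective s, forall e, s e \in sums2 A' & forall e, s e <= 2 * X].
Proof.
move=> sA A0 qX; have [G [sG uG GX sGA]] := greedy sA qX.
exists (G ++ A), (fun e : 'I_q * 'I_q => nth 0 G e.1 + nth 0 G (q + e.2)).
have i1 (i : 'I_q) : i < size G by rewrite sG; have := ltn_ord i; lia.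
have i2 (i : 'I_q) : q + i < size G by rewrite sG; have := ltn_ord i; lia.
have G1 i : i < size G -> nth 0 G i \in G ++ A.
  by move=> iG; rewrite mem_cat mem_nth.
split; split.
- by move=> a aA; rewrite mem_cat aA orbT.
- exact: sGA.
- by rewrite mem_cat negb_or A0 andbT; apply/negP => /GX.
- by rewrite size_cat sG addnC.
- move=> [i j] [i' j'] /= e.
  have [] := sGA _ _ _ _ (G1 _ (i1 i)) (G1 _ (i2 j)) (G1 _ (i1 i'))
    (G1 _ (i2 j')) e.
    move=> E; move: e; rewrite E => /addnI/eqP.
    move/eqP: E; rewrite !nth_uniq // => /eqP/val_inj -> /eqP/addnI/val_inj ->.
    by [].
  move/eqP; rewrite nth_uniq // => /eqP ij.
  by have := ltn_ord i; rewrite ij ltnNge leq_addr.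
- move=> [i j]; apply/sums2P.
  by exists (nth 0 G i), (nth 0 G (q + j)); rewrite !G1.
move=> [i j] /=.
have /andP[_ xX] := GX _ (mem_nth 0 (i1 i)).
have /andP[_ yX] := GX _ (mem_nth 0 (i2 j)).
by rewrite mul2n -addnn leq_add.
Qed.

(** * Covering an interval by repeated random blocks *)

Lemma shrink m (s : 'I_m * 'I_m -> nat) A U :
  0 < m -> injective s -> (forall e, s e \in sums2 A) ->
  (forall e, s e <= 8 * m ^ 4) ->
  sidon_seq A -> 0 \notin A -> (size A + 2 * m) ^ 3 <= m ^ 4 ->
  (forall n, n \in U -> n \notin sums4 A /\ 16 * m ^ 4 < n <= 256 * m ^ 4) ->
  exists A' : seq nat, [/\ {subset A <= A'}, sidon_seq A', 0 \notin A',
    size A' <= size A + 2 * m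
    & size U <= 256 * 256 * count (mem (sums4 A')) U].
Proof.
move=> m0 s_inj sA sm siA A0 Am UP.
(* Taking [K] equal to the bound on [s] gives s + K <= 16 m^4 < n. *)
have [|n /UP[]//||f] :=
  @random_block (256 * m ^ 4) m (8 * m ^ 4) A _ s s_inj sA U.
- by rewrite muln_gt0 expn_gt0 m0.
- by move=> n e /UP[_]; have := sm e; lia.
rewrite !card_prod card_sum !card_ord addnn -mul2n => main.
exists (extend A f); split.
- exact: sub_extend.
- exact: sidon_extend.
- by apply/negP => /mem_extend[|[v _]//]; apply/negP.
- by apply: leq_trans (size_extend _ _) _; rewrite card_sum card_ord; lia.
move: main; set c := count _ _; set a := size A + 2 * m in Am *.
rewrite (_ : m * m * (m * m) = m ^ 4); last by rewrite !expnS expn0; lia.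
have M0 : 0 < m ^ 4 by rewrite expn_gt0 m0.
move: (m ^ 4) M0 (a ^ 3) Am c (size U) => M M0 a3 Am c u main.
(* In units of [u * (M * M)], hits give 8, spoilt hits cost at most 2 and coincidences 1. *)
have {}main : 5 * u * (M * M) <= 256 * 256 * c * (M * M).
  have : u * (M * (2 * a3)) <= u * (M * (2 * M)).
    by rewrite !leq_mul2l Am !orbT.
  by move: main; rewrite -!mulnn; lia.
by move: main; rewrite leq_pmul2r ?muln_gt0 ?M0 //; lia.
Qed.

Lemma shrink_iter D m (s : 'I_m * 'I_m -> nat) t A U :
  256 * 256 <= D -> 0 < m -> injective s -> (forall e, s e \in sums2 A) ->
  (forall e, s e <= 8 * m ^ 4) ->
  sidon_seq A -> 0 \notin A -> (size A + 2 * m * t) ^ 3 <= m ^ 4 ->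
  (forall n, n \in U -> 16 * m ^ 4 < n <= 256 * m ^ 4) ->
  exists A' U' : seq nat, [/\ {subset A <= A'}, sidon_seq A', 0 \notin A',
    size A' <= size A + 2 * m * t
    & {in U, forall n, n \in sums4 A' \/ n \in U'}] /\
    size U' * D ^ t <= size U * D.-1 ^ t.
Proof.
move=> DP m0 s_inj + sm; elim: t A U => [|t IH] A U sA siA A0 Am UP.
  exists A, U; split; last by rewrite !expn0.
  by split=> // [|n nU]; [rewrite muln0 addn0 | right].
(* [shrink] needs uncovered numbers, so the covered ones are dropped first; [W] is what the round
   leaves. *)
pose V := [seq n <- U | n \notin sums4 A].
have [|n|A1 [AA1 siA1 A10 szA1 VA1]] :=
  shrink (U := V) m0 s_inj sA sm siA A0.
- apply: leq_trans Am; rewrite leq_exp2r //; nia.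
- by rewrite mem_filter => /andP[nA /UP].
pose W := [seq n <- V | n \notin sums4 A1].
have [||n|A2 [U2 [[A12 siA2 A20 szA2 WA2] U2W]]] := IH A1 W _ siA1 A10.
- by move=> e; apply: sums2_sub AA1 _ (sA e).
- by apply: leq_trans Am; rewrite leq_exp2r // mulnS addnA leq_add2r.
- by rewrite !mem_filter => /and3P[_ _ /UP].
exists A2, U2; split; first split=> //.
- by move=> a /AA1/A12.
- by apply: leq_trans szA2 _; rewrite mulnS addnA leq_add2r.
- move=> n nU; have [nA|nA] := boolP (n \in sums4 A).
    by left; apply: sums4_sub A12 _ (sums4_sub AA1 nA).
  have [nA1|nA1] := boolP (n \in sums4 A1).
    by left; apply: sums4_sub A12 _ nA1.
  by apply: WA2; rewrite !mem_filter nA1 nA.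
have VU : size V <= size U by rewrite size_filter count_size.
have D0 : 0 < D by apply: leq_trans DP; rewrite muln_gt0.
have WV : size W * D <= size V * D.-1.
  have VW : count (mem (sums4 A1)) V + size W = size V.
    by rewrite size_filter -(count_predC (mem (sums4 A1)) V).
  have {}VA1 := leq_trans VA1 (leq_mul DP (leqnn _)); move: VA1 D0.
  by rewrite -VW; move: (count _ V) (size W) => x y; clear; nia.
rewrite !expnSr !mulnA; apply: leq_trans (leq_mul U2W (leqnn D)) _.
rewrite mulnAC [leqRHS]mulnAC leq_mul2r; apply/orP; right.
by apply: leq_trans WV _; rewrite leq_mul2r VU orbT.
Qed.

Lemma stage D m t A :
  256 * 256 <= D -> 0 < m -> sidon_seq A -> 0 \notin A ->
  (size A + 2 * m * t.+1) ^ 3 <= m ^ 4 ->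
  256 * m ^ 4 * D.-1 ^ t < D ^ t ->
  exists A' : seq nat, [/\ {subset A <= A'}, sidon_seq A', 0 \notin A',
    size A' <= size A + 2 * m * t.+1
    & forall n, 16 * m ^ 4 < n <= 256 * m ^ 4 -> n \in sums4 A'].
Proof.
move=> DP m0 sA A0 Am mt.
(* The greedy step costs as much as one round, hence [t.+1]. The value 4 m^4 exceeds 3 m^4 and keeps
   the sums up to 8 m^4. *)
have [|A1 [s [[A01 sA1 A10 szA1] [s_inj s1 sm]]]] :=
    @greedy_sums A (4 * m ^ 4) m sA A0.
  have M0 : 0 < m ^ 4 by rewrite expn_gt0 m0.
  have : (size A + 2 * m) ^ 3 <= (size A + 2 * m * t.+1) ^ 3.
    by rewrite leq_exp2r //; nia.
  by move: (_ ^ 3) (_ ^ 3) (m ^ 4) M0 Am => x y z; lia.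
have [e||n|A2 [U [[A12 sA2 A20 szA2 UA2] U0]]] := shrink_iter
  (t := t) (U := [seq n <- iota 1 (256 * m ^ 4) | 16 * m ^ 4 < n])
  DP m0 s_inj s1 _ sA1 A10.
- by have := sm e; lia.
- by apply: leq_trans Am; rewrite leq_exp2r // szA1; nia.
- by rewrite mem_filter mem_iota; lia.
exists A2; split=> //.
- by move=> a /A01/A12.
- by apply: leq_trans szA2 _; rewrite szA1; nia.
move=> n nm; case: (UA2 n) => //; first by rewrite mem_filter mem_iota; lia.
(* After [t] rounds less than one number is left uncovered. *)
suff -> : U = [::] by [].
apply: size0nil; apply/eqP; rewrite -leqn0 leqNgt; apply/negP => Upos.
have U1 : size [seq n <- iota 1 (256 * m ^ 4) | 16 * m ^ 4 < n] <= 256 * m ^ 4.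
  by rewrite size_filter -[leqRHS](size_iota 1) count_size.
have := leq_ltn_trans (leq_trans U0 (leq_mul U1 (leqnn _))) mt.
by rewrite ltnNge leq_pmull.
Qed.

(** * Numerical estimates *)

Lemma bernoulli d c : d ^ c * (d + c) <= d.+1 ^ c * d.
Proof.
elim: c => [|c IH]; first by rewrite !expn0 addn0.
have dc : d ^ c <= d.+1 ^ c by case: c {IH} => // c; rewrite leq_exp2r.
by rewrite !expnS; move: (d ^ c) (d.+1 ^ c) IH dc => x y; nia.
Qed.

(** Bernoulli with c = 16 d gives a ratio of at least 17. Thus [c] rounds outweigh the growth of m^4
    = 16^e when [e] increases by one. *)
Lemma shrink_factor D : 1 < D -> exists c, 16 * D.-1 ^ c < D ^ c.
Proof.
case: D => // d d0; exists (16 * d); rewrite /= ltnS in d0 *.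
have := bernoulli d (16 * d); have : 0 < d ^ (16 * d) by rewrite expn_gt0 d0.
by move: (d ^ _) (d.+1 ^ _) => x y; nia.
Qed.

Lemma cube_le_exp C : exists e0, forall e, e0 <= e -> (C * e.+2) ^ 3 <= 2 ^ e.
Proof.
(* At this start, 2^e is the cube of a product of two factors 2^(C + 5), which bound [C] and e +
   2. *)
exists (6 * (C + 5)); elim=> [|e IH]; first by lia.
rewrite leq_eqVlt ltnS => /predU1P[<-|e0e].
  have -> : 2 ^ (6 * (C + 5)) = (2 ^ (C + 5) * 2 ^ (C + 5)) ^ 3.
    by rewrite -expnD -expnM; congr (2 ^ _); lia.
  rewrite leq_exp2r //; apply: leq_mul.
    by have := ltn_expl (C + 5) (isT : 1 < 2); lia.
  elim: C {IH} => [//|C IH]; rewrite addSn expnS.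
  by move: (2 ^ _) IH => x; lia.
have {}IH := IH e0e; rewrite [leqRHS]expnS.
apply: (leq_trans _ (leq_mul (leqnn 2) IH)).
rewrite !expnMn mulnCA leq_mul2l; apply/orP; right.
(* From e = 3 on, (e + 3)^3 <= 2 (e + 2)^3. *)
have : 2 < e by lia.
rewrite !expnS !expn0; nia.
Qed.

Lemma ex_scale X n : 0 < X -> X < n ->
  exists k, X * 16 ^ k < n <= X * 16 ^ k.+1.
Proof.
move=> X0 Xn; have : n <= X * 16 ^ n.
  by apply: leq_trans (leq_pmull _ X0); apply/ltnW/ltn_expl.
elim: {2}n => [|k IH]; first by rewrite muln1 leqNgt Xn.
have [nk _|kn nk] := leqP n (X * 16 ^ k); first exact: IH.
by exists k; rewrite kn.
Qed.

(** * The chain of Sidon sets and its union *)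

(** The state before the stage with m = 2^e; its size O(e m) is below m^(4/3) for large [e], as
    [stage] requires. *)
Definition extendable C e A :=
  [/\ sidon_seq A, 0 \notin A & size A <= C * e.+2 * 2 ^ e].

Lemma sidon_basis_step : exists C e0, forall e A, e0 <= e -> extendable C e A ->
  exists A' : seq nat, [/\ {subset A <= A'}, extendable C e.+1 A'
    & forall n, 16 * 16 ^ e < n <= 16 * 16 ^ e.+1 -> n \in sums4 A'].
Proof.
have [D DP] : exists D, 256 * 256 <= D by exists (256 * 256).
have [|c cP] := @shrink_factor D; first by apply: leq_trans DP.
have [e0 e0P] := cube_le_exp (4 * c.+1).
(* The stage adds at most 2 (c + 1)(e + 2) 2^e elements, as many as the old bound allows; the
   doubling of 2^e absorbs this. *)
exists (2 * c.+1), e0 => e A e0e [sA A0 szA].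
have szA1 : size A + 2 * 2 ^ e * (c * e.+2).+1 <= 4 * c.+1 * e.+2 * 2 ^ e.
  by move: (2 ^ e) szA => x; nia.
have M4 : (2 ^ e) ^ 4 = 16 ^ e by rewrite -!expnM mulnC expnM.
(* [c * e.+2] rounds suffice because 256 m^4 = 16^(e + 2). *)
have [|||A' [AA' sA' A'0 szA' A'P]] := @stage D (2 ^ e) (c * e.+2) A DP _ sA A0.
- by rewrite expn_gt0.
- apply: (@leq_trans ((4 * c.+1 * e.+2 * 2 ^ e) ^ 3)).
    by rewrite leq_exp2r.
  rewrite expnMn [leqRHS]expnS; apply: leq_mul => //; exact: e0P.
- rewrite !expnM M4 (_ : 256 * 16 ^ e = 16 ^ e.+2).
    by rewrite -expnMn ltn_exp2r.
  by rewrite !expnS mulnA.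
exists A'; split=> //; first split=> //.
  apply: leq_trans szA' _; apply: leq_trans szA1 _.
  by rewrite [2 ^ e.+1]expnS; move: (2 ^ e) => x; nia.
by move=> n nP; apply: A'P; rewrite M4; move: nP; rewrite expnS mulnA.
Qed.

From mathcomp Require Import classical_sets boolp.

Theorem theorem1 :
  exists A : set nat, [/\ positive_set A, sidon A & asymptotic_basis 4 A].
Proof.
have [C [e0 step]] := sidon_basis_step.
pose P (x : nat * seq nat) (A' : seq nat) :=
  e0 <= x.1 -> extendable C x.1 x.2 ->
  [/\ {subset x.2 <= A'}, extendable C x.1.+1 A'
    & forall n, 16 * 16 ^ x.1 < n <= 16 * 16 ^ x.1.+1 -> n \in sums4 A'].
have /choice[F FP] : forall x, exists A', P x A'.
  move=> [e A]; have [e0e|ee0] := leqP e0 e; last first.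
    by exists [::]; rewrite /P leqNgt ee0.
  have [eA|neA] := EM (extendable C e A); last by exists [::] => _ /neA.
  by have [A' A'P] := step e A e0e eA; exists A'.
(* The chain starts from the empty set, and its step from [k] to [k.+1] is the stage with e = e0 +
   k. *)
pose S := fix S k := if k is k'.+1 then F (e0 + k', S k') else [::].
have Sext k : extendable C (e0 + k) (S k).
  elim: k => [//|k IH]; rewrite addnS.
  by have [] := FP (e0 + k, S k) (leq_addr _ _) IH.
have Ssub j k : j <= k -> {subset S j <= S k}.
  move=> /subnK <-; elim: (k - j) => // d IH a /IH aS.
  have [sub _ _] := FP (e0 + (d + j), S (d + j)) (leq_addr _ _) (Sext _).
  exact: sub.
exists (fun a => exists k, a \in S k); split.
- move=> a [k aS] /=; rewrite lt0n; apply: contraTneq aS => ->.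
  by have [] := Sext k.
- move=> a b c d [i ai] [j bj] [k ck] [l dl] ab cd e.
  (* All four terms lie in [S N]; in the swapped case [a = d], the orderings force all four to be
     equal. *)
  pose N := maxn (maxn i j) (maxn k l).
  have [sN _ _] := Sext N.
  have [||||ac|ad] := sN a b c d _ _ _ _ e.
  + by apply: Ssub ai; rewrite /N; lia.
  + by apply: Ssub bj; rewrite /N; lia.
  + by apply: Ssub ck; rewrite /N; lia.
  + by apply: Ssub dl; rewrite /N; lia.
  + by lia.
  + by lia.
(* Beyond this bound, the intervals of the stages e >= e0 leave no gap. *)
exists (16 * 16 ^ e0) => n en.
have [|k] := ex_scale _ en; first by rewrite muln_gt0 expn_gt0.
rewrite -!mulnA -!expnD addnS => nk.
have [_ _ /(_ n nk)] := FP (e0 + k, S k) (leq_addr _ _) (Sext _).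
case/sums4P => s [t [/sums2P[a [b [aS bS ->]]] /sums2P[c [d [cS dS ->]]] ->]].
exists (fun i : 'I_4 => nth 0 [:: a; b; c; d] i); split.
  by case; do 4?[case=> [|]]; move=> //= *; exists k.+1.
by rewrite !big_ord_recl big_ord0 /= addn0 !addnA.
Qed.
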